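(* The map $S$ is a derivation on the algebra $(\hat{\mathcal F},\cdot)$, that is, \[ S \circ \cdot = \cdot \circ (\operatorname{id} \otimes S + S \otimes \operatorname{id}), \] i.e. $S(u \cdot v) = S(u) \cdot v + u \cdot S(v)$ for $u,v \in \hat{\mathcal F}$. Also, $S(1) = e$ and $S(e) = 0$.
   Context: Let $k$ be a field of characteristic 0 and $\mathcal F = k\langle \mathbf c,\mathbf d\rangle$ the free algebra in non-commuting variables $\mathbf c$ (degree 1) and $\mathbf d$ (degree 2), with concatenation product and unit $1$. Let $\hat{\mathcal F} = k e \oplus \mathcal F$, where $e$ is a formal symbol of degree $-1$; by convention $e v = v e = 0$ under concatenation. The cd-monomials together with $e$ form a basis of $\hat{\mathcal F}$. Coproduct: $\Delta\colon\mathcal F\to\mathcal F\otimes\mathcal F$ is given by $\Delta(1)=0$, $\Delta(\mathbf c)=2(1\otimes 1)$, $\Delta(\mathbf d)=1\otimes\mathbf c+\mathbf c\otimes 1$ and $\Delta(uv)=\Delta(u)v+u\Delta(v)$. Extend to $\hat\Delta\colon\hat{\mathcal F}\to\hat{\mathcal F}\otimes\hat{\mathcal F}$ by $\hat\Delta(e)=e\otimes e$ and $\hat\Delta(u)=\Delta(u)+e\otimes u+u\otimes e$ for $u\in\mathcal F$. Map $\hat G$: let $G\colon\mathcal F\to\mathcal F$ be the linear map with $G(1)=0$, $G(\mathbf c)=\mathbf d$, $G(\mathbf d)=\mathbf c\mathbf d$ and $G(uv)=G(u)v+uG(v)$; define $\hat G\colon\hat{\mathcal F}\to\hat{\mathcal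 F}$ by $\hat G(e)=1$ and $\hat G(u)=G(u)+u\mathbf c$ for $u\in\mathcal F$. Identify $\hat{\mathcal F}$ with its graded dual via the monomial basis ($v\leftrightarrow\delta_v$). The product $\cdot\colon\hat{\mathcal F}\otimes\hat{\mathcal F}\to\hat{\mathcal F}$ (not concatenation) is the transpose of $\hat\Delta$: for monomials $u,v,w$, the coefficient of $w$ in $u\cdot v$ equals the coefficient of $u\otimes v$ in $\hat\Delta(w)$. It is associative with unit $e$; explicitly, writing the monomial $\mathbf c^{m_1}\mathbf d\mathbf c^{m_2}\mathbf d\cdots\mathbf d\mathbf c^{m_k}$ as the list $(m_1,\dots,m_k)$, one has $(M',m)\cdot(n,N') = (M',m-1,n,N')+(M',m,n-1,N')+2(M',m+n+1,N')$, lists with negative entries being zero. The map $S\colon\hat{\mathcal F}\to\hat{\mathcal F}$ is the transpose of $\hat G$: the coefficient of $w$ in $S(v)$ equals the coefficient of $v$ in $\hat G(w)$. *)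

(* Defs.v *)
From HB Require Import structures.
From mathcomp Require Import all_boot all_order all_algebra.
From mathcomp Require Import finmap.
From mathcomp Require Import monalg.

Set Implicit Arguments.
Unset Strict Implicit.
Unset Printing Implicit Defensive.

Import GRing.Theory.

Local Open Scope ring_scope.

(* Locked, so that conversion does not unfold it down to finite maps. *)
HB.lock Definition lin_ext (k : fieldType) (A : choiceType) (V : lmodType k)
  (f : A -> V) (x : {malg k[A]}) : V := \sum_(a <- msupp x) x@_a *: f a.
Arguments lin_ext {k A V} f x.

Section LinearExtension.
Context {k : fieldType} {A : choiceType} {V : lmodType k}.
Implicit Types (f : A -> V) (x y : {malg k[A]}).

Lemma lin_extE f x : lin_ext f x = \sum_(a <- msupp x) x@_a *: f a.
Proof. by rewrite unlock. Qed.

Lemma lin_extEw f x (E : {fset A}) :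
  (msupp x `<=` E)%fset -> lin_ext f x = \sum_(a <- E) x@_a *: f a.
Proof.
move=> le; rewrite lin_extE (big_fset_incl _ le) //= => a _ /mcoeff_outdom ->.
by rewrite scale0r.
Qed.

Lemma lin_ext_is_linear f : linear (lin_ext f).
Proof.
move=> c x y; pose E := (msupp x `|` msupp y)%fset.
have lex : (msupp x `<=` E)%fset by apply: fsubsetUl.
have ley : (msupp y `<=` E)%fset by apply: fsubsetUr.
have lexy : (msupp (c *: x + y) `<=` E)%fset.
  apply: fsubset_trans (msuppD_le _ _) _.
  by apply: fsetSU; apply: msuppZ_le.
rewrite (lin_extEw _ lex) (lin_extEw _ ley) (lin_extEw _ lexy).
rewrite scaler_sumr -big_split; apply: eq_bigr => a _ /=.
by rewrite mcoeffD mcoeffZ scalerDl scalerA.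
Qed.

HB.instance Definition _ f :=
  GRing.isLinear.Build k {malg k[A]} V *:%R (lin_ext f) (lin_ext_is_linear f).

Lemma lin_extU f a : lin_ext f << a >> = f a.
Proof. by rewrite (lin_extEw _ msuppU_le) big_seq_fset1 mcoeffUU scale1r. Qed.

End LinearExtension.

Lemma malg_lin_ext (k : fieldType) (A : choiceType) (x : {malg k[A]}) : x = lin_ext (fun a => << a >>) x.
Proof.
rewrite [LHS]monalgE lin_extE; apply: eq_bigr => a _.
by apply/malgP => b; rewrite mcoeffZ !mcoeffU mulrnAr mulr1.
Qed.

(* The tensor product of the free modules on A and on B is represented as the
   free module on A * B, the pair (a, b) standing for a (x) b. *)
Section Tensor.
Context {k : fieldType}.

Definition tens {A B : choiceType} (x : {malg k[A]}) (y : {malg k[B]}) :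
    {malg k[(A * B)%type]} :=
  lin_ext (fun a => lin_ext (fun b => << (a, b) >>) y) x.

Definition tmap {A B A' B' : choiceType} (f : {malg k[A]} -> {malg k[A']})
    (g : {malg k[B]} -> {malg k[B']}) : {malg k[(A * B)%type]} -> {malg k[(A' * B')%type]} :=
  lin_ext (fun p => tens (f << p.1 >>) (g << p.2 >>)).

HB.instance Definition _ (A B A' B' : choiceType) f g :=
  GRing.Linear.copy (@tmap A B A' B' f g) (lin_ext _).

End Tensor.

(* When every b occurs in f a only for a in the (duplicate-free) list c b, this
   is the transpose of f with respect to the two bases; see transposeE. *)
Definition transpose {k : fieldType} {A B : choiceType} (c : B -> seq A)
    (f : {malg k[A]} -> {malg k[B]}) : {malg k[B]} -> {malg k[A]} :=
  lin_ext (fun b => \sum_(a <- c b) (f << a >>)@_b *: << a >>).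

HB.instance Definition _ (k : fieldType) (A B : choiceType) c f :=
  GRing.Linear.copy (@transpose k A B c f) (lin_ext _).

Lemma transposeE (k : fieldType) (A B : choiceType) (c : B -> seq A)
    (f : {malg k[A]} -> {malg k[B]}) a b :
    uniq (c b) -> ((f << a >>)@_b != 0 -> a \in c b) ->
  (transpose c f << b >>)@_a = (f << a >>)@_b.
Proof.
move=> uc ac; rewrite /transpose lin_extU raddf_sum /=.
have [a_in|a_nin] := boolP (a \in c b).
  rewrite (bigD1_seq a) //= mcoeffZ mcoeffUU mulr1 big1 ?addr0 // => i ia.
  by rewrite mcoeffZ mcoeffU (negPf ia) mulr0.
have /eqP -> : (f << a >>)@_b == 0 by apply: contraNT a_nin.
rewrite big_seq big1 // => i ic; rewrite mcoeffZ mcoeffU.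
by case: eqP ic => [->|]; rewrite ?(negPf a_nin) ?mulr0.
Qed.

Inductive letter := Lc | Ld.

Definition bool_of_letter l := if l is Lc then false else true.
Definition letter_of_bool b := if b then Ld else Lc.
Lemma bool_of_letterK : cancel bool_of_letter letter_of_bool.
Proof. by case. Qed.

HB.instance Definition _ := Countable.copy letter (can_type bool_of_letterK).

Notation cdmon := {fmonom letter}.
Notation cdword := (@FMonom letter).

Notation cdF k := {malg k[cdmon]}.

(* k e (+) cdF k, the symbol e being the basis element indexed by None *)
Notation cdFh k := {malg k[option cdmon]}.

Section CD.
Context (k : fieldType).

Local Notation F := (cdF k).
Local Notation FF := {malg k[(cdmon * cdmon)%type]}.
Local Notation Fh := (cdFh k).
Local Notation FhFh := {malg k[(option cdmon * option cdmon)%type]}.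

Definition cdc : F := << cdword [:: Lc] >>.
Definition cdd : F := << cdword [:: Ld] >>.

Definition cd_e : Fh := << None >>.
Definition cd_incl : F -> Fh := lin_ext (fun w => << Some w >>).

Definition lact (u : F) : FF -> FF := tmap ( *%R u) id.
Definition ract (t : FF) (v : F) : FF := tmap id ( *%R^~ v) t.

Definition Delta_letter (l : letter) : FF :=
  match l with
  | Lc => 2 *: tens (1 : F) (1 : F)
  | Ld => tens (1 : F) cdc + tens cdc (1 : F)
  end.

Fixpoint Delta_word (w : seq letter) : FF :=
  if w is l :: w' then
    ract (Delta_letter l) << cdword w' >>
    + lact << cdword [:: l] >> (Delta_word w')
  else 0.

Definition Delta : F -> FF := lin_ext (fun w : cdmon => Delta_word w).

Definition G_letter (l : letter) : F :=
  match l with Lc => cdd | Ld => cdc * cdd end.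

Fixpoint G_word (w : seq letter) : F :=
  if w is l :: w' then
    G_letter l * << cdword w' >> + << cdword [:: l] >> * G_word w'
  else 0.

Definition cdG : F -> F := lin_ext (fun w : cdmon => G_word w).

Definition Delta_hat : Fh -> FhFh := lin_ext (fun w : option cdmon =>
  if w is Some w' then
    tmap cd_incl cd_incl (Delta << w' >>)
    + tens cd_e << w >> + tens << w >> cd_e
  else tens cd_e cd_e).

Definition cdG_hat : Fh -> Fh := lin_ext (fun w : option cdmon =>
  if w is Some w' then cd_incl (cdG << w' >> + << w' >> * cdc)
  else cd_incl 1).

HB.instance Definition _ := GRing.Linear.copy cd_incl (lin_ext _).
HB.instance Definition _ := GRing.Linear.copy Delta (lin_ext _).
HB.instance Definition _ := GRing.Linear.copy cdG (lin_ext _).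
HB.instance Definition _ := GRing.Linear.copy Delta_hat (lin_ext _).
HB.instance Definition _ := GRing.Linear.copy cdG_hat (lin_ext _).

End CD.

Arguments cd_e {k}.
Arguments cdc {k}.
Arguments cdd {k}.

Definition letter_deg (l : letter) : nat := if l is Lc then 1 else 2.
Definition word_deg (w : seq letter) : nat := sumn (map letter_deg w).

(* The degree shifted by 1, so that e gets degree 0. *)
Definition hdeg (w : option cdmon) : nat :=
  if w is Some w' then (word_deg w').+1 else 0.

Fixpoint words (n : nat) : seq (seq letter) :=
  match n with
  | 0 => [:: [::]]
  | n1.+1 => map (cons Lc) (words n1)
             ++ (if n1 is n2.+1 then map (cons Ld) (words n2) else [::])
  end.

Definition hwords (n : nat) : seq (option cdmon) :=
  if n is n'.+1 then map (fun w => Some (cdword w)) (words n') else [:: None].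

(* Delta_hat preserves, and cdG_hat raises by 1, the shifted degree; hence the
   basis elements listed below suffice to compute the two transposes; see
   cdmul_coef and cdS_coef. *)
Definition cdmulT (k : fieldType) :
    {malg k[(option cdmon * option cdmon)%type]} -> cdFh k :=
  transpose (fun p => hwords (hdeg p.1 + hdeg p.2)) (@Delta_hat k).

Definition cdmul (k : fieldType) (u v : cdFh k) : cdFh k := cdmulT (tens u v).

Definition cdS (k : fieldType) : cdFh k -> cdFh k :=
  transpose (fun v => hwords (hdeg v).-1) (@cdG_hat k).

HB.instance Definition _ k := GRing.Linear.copy (@cdmulT k) (transpose _ _).
HB.instance Definition _ k := GRing.Linear.copy (@cdS k) (transpose _ _).

Lemma linear_lin_ext (k : fieldType) (A : choiceType) (V : lmodType k)
    (f : {malg k[A]} -> V) :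
  linear f -> f =1 lin_ext (fun a => f << a >>).
Proof.
move=> lf x; pose L := GRing.isLinear.Build _ _ _ _ f lf.
pose h : {linear _ -> V} := HB.pack f L.
have {1}-> : x = \sum_(a <- msupp x) x@_a *: << a >>.
  by rewrite -lin_extE -malg_lin_ext.
rewrite -[LHS]/(h _) linear_sum lin_extE; apply: eq_bigr => a _; exact: linearZ.
Qed.

Lemma malg_linear_ext (k : fieldType) (A : choiceType) (V : lmodType k)
    (f g : {malg k[A]} -> V) :
  linear f -> linear g -> (forall a, f << a >> = g << a >>) -> f =1 g.
Proof.
move=> lf lg fg x; rewrite (linear_lin_ext lf) (linear_lin_ext lg).
by rewrite !lin_extE; apply: eq_bigr => a _; rewrite fg.
Qed.

Lemma lin_swap (k : fieldType) (V : lmodType k) (c d : k) (a b x y : V) :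
  c *: (d *: a + b) + (d *: x + y) = d *: (c *: a + x) + (c *: b + y).
Proof. by rewrite !scalerDr addrACA !scalerA [c * d]mulrC. Qed.

Lemma lin_add (k : fieldType) (V : lmodType k) (c : k) (a b x y : V) :
  c *: a + x + (c *: b + y) = c *: (a + b) + (x + y).
Proof. by rewrite scalerDr addrACA. Qed.

Lemma leibniz_cons (R : pzRingType) (a b c d e f : R) :
  a * (b * c) + d * (e * c + b * f) = (a * b + d * e) * c + d * b * f.
Proof. by rewrite mulrDr mulrDl !mulrA addrA. Qed.

Section TensorTheory.
Context {k : fieldType}.

Lemma mcoeff_lin_ext (A B : choiceType) (f : A -> {malg k[B]}) x b :
  (lin_ext f x)@_b = \sum_(a <- msupp x) x@_a * (f a)@_b.
Proof. by rewrite lin_extE raddf_sum; apply: eq_bigr => a _; rewrite /= mcoeffZ. Qed.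

Lemma mcoeff_tens (A B : choiceType) (x : {malg k[A]}) (y : {malg k[B]}) a b :
  (tens x y)@_(a, b) = x@_a * y@_b.
Proof.
have aux (C : choiceType) (z : {malg k[C]}) c :
    \sum_(i <- msupp z) z@_i * (i == c)%:R = z@_c.
  rewrite [in RHS](malg_lin_ext z) mcoeff_lin_ext; apply: eq_bigr => i _.
  by rewrite mcoeffU.
rewrite /tens mcoeff_lin_ext -[in RHS]aux mulr_suml.
apply: eq_bigr => i _; rewrite -mulrA mcoeff_lin_ext; congr (_ * _).
rewrite -(aux _ y b) mulr_sumr; apply: eq_bigr => j _.
by rewrite mcoeffU xpair_eqE; do 2 case: (_ == _); rewrite ?mul1r ?mul0r ?mulr0.
Qed.

Lemma tensU (A B : choiceType) (a : A) (b : B) :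
  tens << a >> << b >> = << (a, b) >> :> {malg k[(A * B)%type]}.
Proof. by rewrite /tens !lin_extU. Qed.

Lemma tens_linearl (A B : choiceType) (y : {malg k[B]}) :
  linear (fun x : {malg k[A]} => tens x y).
Proof.
move=> c x x'; apply/malgP => -[a b].
by rewrite mcoeffD mcoeffZ !mcoeff_tens mcoeffD mcoeffZ mulrDl mulrA.
Qed.

Lemma tens_linearr (A B : choiceType) (x : {malg k[A]}) :
  linear (fun y : {malg k[B]} => tens x y).
Proof.
move=> c y y'; apply/malgP => -[a b].
by rewrite mcoeffD mcoeffZ !mcoeff_tens mcoeffD mcoeffZ mulrDr (mulrCA _ c).
Qed.

Lemma tmap_tens (A B A' B' : choiceType) (f : {malg k[A]} -> {malg k[A']})
    (g : {malg k[B]} -> {malg k[B']}) x y :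
  linear f -> linear g -> tmap f g (tens x y) = tens (f x) (g y).
Proof.
move=> lf lg; move: x; apply: malg_linear_ext => [c u v|c u v|a].
- by rewrite tens_linearl linearP.
- by rewrite lf tens_linearl.
move: y; apply: malg_linear_ext => [c u v|c u v|b].
- by rewrite tens_linearr linearP.
- by rewrite lg tens_linearr.
by rewrite tensU /tmap lin_extU.
Qed.

Lemma tmap_comp (A B A' B' A2 B2 : choiceType)
    (f : {malg k[A]} -> {malg k[A']}) (g : {malg k[B]} -> {malg k[B']})
    (f' : {malg k[A']} -> {malg k[A2]}) (g' : {malg k[B']} -> {malg k[B2]}) t :
  linear f' -> linear g' ->
  tmap f' g' (tmap f g t) = tmap (f' \o f) (g' \o g) t.
Proof.
move=> lf' lg'; move: t; apply: malg_linear_ext => [c u v|c u v|p].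
- by rewrite !linearP.
- by rewrite linearP.
by rewrite {2}/tmap lin_extU tmap_tens // /tmap lin_extU.
Qed.

Lemma eq_tmap (A B A' B' : choiceType)
    (f f' : {malg k[A]} -> {malg k[A']}) (g g' : {malg k[B]} -> {malg k[B']}) :
  f =1 f' -> g =1 g' -> tmap f g =1 tmap f' g'.
Proof.
by move=> ff gg t; rewrite /tmap !lin_extE; apply: eq_bigr => p _; rewrite ff gg.
Qed.

End TensorTheory.

Section CDTheory.
Context (k : fieldType).
Local Notation F := (cdF k).
Local Notation Fh := (cdFh k).

Lemma mull_linear (u : F) : linear ( *%R u).
Proof.
move=> c x y; rewrite mulrDr; congr (_ + _).
have uc : u * c%:MP = c *: u.
  rewrite malgM_def fgmulgU malgZ_def; apply: eq_bigr => i _.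
  by rewrite mulm1 mulrC.
by rewrite -mul_malgC mulrA uc scalerAl.
Qed.

Lemma mulr_linear (u : F) : linear ( *%R^~ u).
Proof. by move=> c x y; rewrite mulrDl -scalerAl. Qed.

Lemma id_linear (A : choiceType) : linear (@id {malg k[A]}).
Proof. by []. Qed.

Lemma ractA t (u v : F) : ract t (u * v) = ract (ract t u) v.
Proof.
rewrite /ract [RHS]tmap_comp; [|exact: id_linear|exact: mulr_linear].
by apply: eq_tmap => x; [reflexivity|exact: mulrA].
Qed.

Lemma lactA t (u v : F) : lact (u * v) t = lact u (lact v t).
Proof.
rewrite /lact [RHS]tmap_comp; [|exact: mull_linear|exact: id_linear].
by apply: eq_tmap => x; [symmetry; exact: mulrA|reflexivity].
Qed.

Lemma lract t (u v : F) : ract (lact u t) v = lact u (ract t v).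
Proof.
rewrite /lact /ract [LHS]tmap_comp; [|exact: id_linear|exact: mulr_linear].
rewrite [RHS]tmap_comp; [|exact: mull_linear|exact: id_linear].
by apply: eq_tmap => x; reflexivity.
Qed.

Lemma ractU p (v : F) : ract << p >> v = tens << p.1 >> (<< p.2 >> * v).
Proof. by rewrite /ract /tmap lin_extU. Qed.

Lemma lactU p (u : F) : lact u << p >> = tens (u * << p.1 >>) << p.2 >>.
Proof. by rewrite /lact /tmap lin_extU. Qed.

Lemma ract_linearl (v : F) : linear (fun t => ract t v).
Proof. by move=> c s t; rewrite /ract linearP. Qed.

Lemma lact_linearr (u : F) : linear (lact u).
Proof. by move=> c s t; rewrite /lact linearP. Qed.

Lemma ractD s t (v : F) : ract (s + t) v = ract s v + ract t v.
Proof. by rewrite /ract linearD. Qed.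

Lemma lactD (u : F) s t : lact u (s + t) = lact u s + lact u t.
Proof. by rewrite /lact linearD. Qed.

Lemma ract_linearr t : linear (fun v : F => ract t v).
Proof.
move=> c u v; move: t; apply: malg_linear_ext => [d s t|d s t|p].
- exact: ract_linearl.
- rewrite (ract_linearl u d s t) (ract_linearl v d s t).
  exact: lin_swap.
by rewrite (ractU p _) (ractU p u) (ractU p v) mull_linear tens_linearr.
Qed.

Lemma lact_linearl t : linear (fun u : F => lact u t).
Proof.
move=> c u v; move: t; apply: malg_linear_ext => [d s t|d s t|p].
- exact: lact_linearr.
- rewrite (lact_linearr u d s t) (lact_linearr v d s t).
  exact: lin_swap.
by rewrite (lactU p _) (lactU p u) (lactU p v) mulr_linear tens_linearl.
Qed.

Lemma ract1 t : ract t (1 : F) = t.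
Proof.
move: t; apply: malg_linear_ext => [||p]; [exact: ract_linearl|by []|].
by rewrite /ract /tmap lin_extU mulr1 tensU -surjective_pairing.
Qed.

Lemma lact1 t : lact (1 : F) t = t.
Proof.
move: t; apply: malg_linear_ext => [||p]; [exact: lact_linearr|by []|].
by rewrite /lact /tmap lin_extU mul1r tensU -surjective_pairing.
Qed.

Lemma cdword0 : 1 = << cdword [::] >> :> F.
Proof.
rewrite -[LHS]/(@mkmalgU {fmonom letter} k (@mone _) 1).
congr (mkmalgU _ _).
by apply: val_inj; exact: fm1.
Qed.

Lemma cdwordM w w' :
  << cdword w >> * << cdword w' >> = << cdword (w ++ w') >> :> F.
Proof.
rewrite malgM_def fgmulUU mulr1; congr (mkmalgU _ _).
by apply: val_inj; rewrite /= fmM.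
Qed.

Lemma Delta1 : Delta (1 : F) = 0.
Proof. by rewrite cdword0 /Delta lin_extU. Qed.

Lemma Delta_l l : Delta (<< cdword [:: l] >> : F) = Delta_letter k l.
Proof.
by rewrite /Delta lin_extU /= -cdword0 ract1 [lact _ _]linear0 addr0.
Qed.

Lemma Delta_c : Delta (cdc : F) = 2 *: tens 1 1.
Proof. exact: Delta_l. Qed.

Lemma Delta_d : Delta (cdd : F) = tens 1 cdc + tens cdc 1.
Proof. exact: Delta_l. Qed.

Lemma DeltaM (u v : F) : Delta (u * v) = ract (Delta u) v + lact u (Delta v).
Proof.
move: u; apply: malg_linear_ext => [c x y|c x y|[u]].
- by rewrite mulr_linear /Delta linearP.
- by rewrite /Delta linearP ract_linearl lact_linearl lin_add.
move: v; apply: malg_linear_ext => [c x y|c x y|[v]].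
- by rewrite mull_linear /Delta linearP.
- by rewrite /Delta linearP ract_linearr lact_linearr lin_add.
rewrite cdwordM /Delta !lin_extU /=.
elim: u => [|l u IH] /=.
  by rewrite -cdword0 lact1 /ract linear0 add0r.
rewrite IH lactD ractD lract -ractA cdwordM -lactA cdwordM.
exact: addrA.
Qed.

Lemma cdG1 : cdG (1 : F) = 0.
Proof. by rewrite cdword0 /cdG lin_extU. Qed.

Lemma cdG_l l : cdG (<< cdword [:: l] >> : F) = G_letter k l.
Proof. by rewrite /cdG lin_extU /= -cdword0 mulr1 mulr0 addr0. Qed.

Lemma cdG_c : cdG (cdc : F) = cdd.
Proof. exact: cdG_l. Qed.

Lemma cdG_d : cdG (cdd : F) = cdc * cdd.
Proof. exact: cdG_l. Qed.

Lemma cdGM (u v : F) : cdG (u * v) = cdG u * v + u * cdG v.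
Proof.
move: u; apply: malg_linear_ext => [c x y|c x y|[u]].
- by rewrite mulr_linear /cdG linearP.
- by rewrite /cdG linearP !mulr_linear lin_add.
move: v; apply: malg_linear_ext => [c x y|c x y|[v]].
- by rewrite mull_linear /cdG linearP.
- by rewrite /cdG linearP !mull_linear lin_add.
rewrite cdwordM /cdG !lin_extU /=.
elim: u => [|l u IH] /=; first by rewrite -cdword0 mul1r mul0r add0r.
rewrite IH -(cdwordM u v) -[in RHS](cdwordM [:: l] u); exact: leibniz_cons.
Qed.

Lemma cd_inclU w : cd_incl (<< w >> : F) = << Some w >>.
Proof. by rewrite /cd_incl lin_extU. Qed.

Lemma Delta_hat_e : Delta_hat (cd_e : Fh) = tens cd_e cd_e.
Proof. by rewrite /Delta_hat lin_extU. Qed.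

Lemma Delta_hat_incl (u : F) :
  Delta_hat (cd_incl u) = tmap (@cd_incl k) (@cd_incl k) (Delta u)
    + tens cd_e (cd_incl u) + tens (cd_incl u) cd_e.
Proof.
move: u; apply: malg_linear_ext => [c x y|c x y|u].
- by rewrite /cd_incl linearP /Delta_hat linearP.
- rewrite /cd_incl /Delta !linearP -/(@cd_incl k) tens_linearl tens_linearr.
  by rewrite !lin_add.
by rewrite cd_inclU /Delta_hat lin_extU.
Qed.

Lemma cdG_hat_e : cdG_hat (cd_e : Fh) = cd_incl 1.
Proof. by rewrite /cdG_hat lin_extU. Qed.

Lemma cdG_hat_incl (u : F) :
  cdG_hat (cd_incl u) = cd_incl (cdG u + u * cdc).
Proof.
move: u; apply: malg_linear_ext => [c x y|c x y|u].
- by rewrite /cd_incl linearP /cdG_hat linearP.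
- by rewrite /cdG linearP mulr_linear lin_add linearP.
by rewrite cd_inclU /cdG_hat lin_extU.
Qed.

Lemma word_deg_cat u v : word_deg (u ++ v) = (word_deg u + word_deg v)%N.
Proof. by rewrite /word_deg map_cat sumn_cat. Qed.

Lemma word_deg_cons l w : word_deg (l :: w) = (letter_deg l + word_deg w)%N.
Proof. by []. Qed.

Lemma mem_map_cons (l l' : letter) w (s : seq (seq letter)) :
  (l :: w \in map (cons l') s) = (l == l') && (w \in s).
Proof.
apply/mapP/andP => [[y ys [-> ->]]|[/eqP -> ws]]; first by rewrite eqxx.
by exists w.
Qed.

Lemma mem_words n w : (w \in words n) = (word_deg w == n).
Proof.
elim: w n => [|l w IH] [|n] //.
- rewrite /= mem_cat; apply/norP; split; first by apply/mapP => -[].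
  by case: n => // n; apply/mapP => -[].
- by rewrite word_deg_cons; case: l.
rewrite /= mem_cat mem_map_cons IH word_deg_cons.
case: n => [|n]; first by rewrite orbF; case: l.
by rewrite mem_map_cons IH; case: l; rewrite ?orbF.
Qed.

Lemma words_uniq n : uniq (words n).
Proof.
have inj l : injective (cons l : seq letter -> _) by move=> x y [].
have [m] := ubnP n; elim: m n => // m IH [|n] //= le.
rewrite cat_uniq map_inj_uniq // IH //=.
case: n le => // n le; rewrite map_inj_uniq // IH ?andbT 1?ltnW //.
by apply/hasPn => x /mapP[y _ ->]; apply/mapP => -[].
Qed.

Lemma mem_hwords n w : (w \in hwords n) = (hdeg w == n).
Proof.
have inj : injective (fun w : seq letter => Some (cdword w)) by move=> x y [].
case: n w => [|n] [[w]|] //=; first by rewrite (mem_map inj) mem_words.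
by apply/mapP => -[].
Qed.

Lemma hwords_uniq n : uniq (hwords n).
Proof. by case: n => //= n; rewrite map_inj_uniq ?words_uniq // => x y []. Qed.

Definition homog {A : choiceType} (d : A -> nat) n (x : {malg k[A]}) :=
  forall a, x@_a != 0 -> d a = n.

Lemma homog0 (A : choiceType) (d : A -> nat) n : homog d n 0.
Proof. by move=> a; rewrite mcoeff0 eqxx. Qed.

Lemma homogD (A : choiceType) (d : A -> nat) n x y :
  homog d n x -> homog d n y -> homog d n (x + y).
Proof.
move=> hx hy a; rewrite mcoeffD.
have [->|/hx //] := eqVneq x@_a 0; by rewrite add0r => /hy.
Qed.

Lemma homogZ (A : choiceType) (d : A -> nat) n c x :
  homog d n x -> homog d n (c *: x).
Proof.
by move=> hx a; rewrite mcoeffZ mulf_eq0 negb_or => /andP[_ /hx].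
Qed.

Lemma homogU (A : choiceType) (d : A -> nat) a : homog d (d a) << a >>.
Proof. by move=> b; rewrite mcoeffU; have [->|_] := eqVneq a b; rewrite ?eqxx. Qed.

Lemma homog_lin_ext (A B : choiceType) (dA : A -> nat) (dB : B -> nat) m n
    (f : A -> {malg k[B]}) x :
  homog dA m x -> (forall a, dA a = m -> homog dB n (f a)) ->
  homog dB n (lin_ext f x).
Proof.
move=> hx hf; rewrite lin_extE big_seq.
elim/big_rec: _ => [|a y]; first exact: homog0.
rewrite -mcoeff_neq0 => /hx /hf ha hy; apply: homogD => //; exact: homogZ.
Qed.

Lemma homog_tens (A B : choiceType) (dA : A -> nat) (dB : B -> nat)
    (d : A * B -> nat) s m n x y :
  (forall p, d p = dA p.1 + dB p.2 + s)%N ->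
  homog dA m x -> homog dB n y -> homog d (m + n + s)%N (tens x y).
Proof.
move=> dE hx hy [a b]; rewrite mcoeff_tens mulf_eq0 negb_or => /andP[].
by rewrite dE /= => /hx -> /hy ->.
Qed.

Definition wdeg (w : cdmon) := word_deg w.
Definition tdeg (p : cdmon * cdmon) := (wdeg p.1 + wdeg p.2 + 1)%N.
Definition thdeg (p : option cdmon * option cdmon) :=
  (hdeg p.1 + hdeg p.2 + 0)%N.

Lemma homogM m n (x y : F) :
  homog wdeg m x -> homog wdeg n y -> homog wdeg (m + n)%N (x * y).
Proof.
move=> hx hy a; rewrite mcoeff_neq0 => /msuppM_le [b [c [+ + ->]]].
rewrite -!mcoeff_neq0 => /hx <- /hy <-.
by rewrite /wdeg fmM word_deg_cat.
Qed.

Lemma homog_word w : homog wdeg (word_deg w) (<< cdword w >> : F).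
Proof. exact: homogU. Qed.

Lemma homog1 : homog wdeg 0 (1 : F).
Proof. by rewrite cdword0; exact: homog_word. Qed.

Lemma homog_ract m n t (v : F) :
  homog tdeg m t -> homog wdeg n v -> homog tdeg (m + n)%N (ract t v).
Proof.
move=> ht hv; apply: (homog_lin_ext ht) => -[a b] <-.
rewrite /tdeg /= -addnA [(1 + n)%N]addnC !addnA -(addnA (wdeg a)).
apply: (homog_tens (dA := wdeg) (dB := wdeg)) => //; first exact: homogU.
by apply: homogM => //; exact: homogU.
Qed.

Lemma homog_lact m n t (u : F) :
  homog wdeg m u -> homog tdeg n t -> homog tdeg (m + n)%N (lact u t).
Proof.
move=> hu ht; apply: (homog_lin_ext ht) => -[a b] <-.
rewrite /tdeg /= !addnA.
apply: (homog_tens (dA := wdeg) (dB := wdeg)) => //; last exact: homogU.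
by apply: homogM => //; exact: homogU.
Qed.

Lemma homog_Delta_word w : homog tdeg (word_deg w) (Delta_word k w).
Proof.
elim: w => [|l w IH] /=; first exact: homog0.
rewrite -[l :: w]cat1s word_deg_cat; apply: homogD.
  apply: homog_ract; last exact: homog_word.
  have h := homog_tens (dA := wdeg) (dB := wdeg) (d := tdeg) (s := 1%N).
  case: l; rewrite /=.
    by apply: homogZ; apply: (h 0 0) => //; exact: homog1.
  apply: homogD.
    by apply: (h 0 1) => //; [exact: homog1|exact: homog_word].
  by apply: (h 1 0) => //; [exact: homog_word|exact: homog1].
by apply: homog_lact => //; exact: homog_word.
Qed.

Lemma homog_G_word w : homog wdeg (word_deg w).+1 (G_word k w).
Proof.
elim: w => [|l w IH] /=; first exact: homog0.
rewrite -[l :: w]cat1s word_deg_cat; apply: homogD.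
  rewrite -addSn; apply: homogM; last exact: homog_word.
  case: l => /=; first exact: homog_word.
  by rewrite cdwordM; exact: homog_word.
by rewrite -addnS; apply: homogM => //; exact: homog_word.
Qed.

Lemma homog_incl n u : homog wdeg n u -> homog hdeg n.+1 (@cd_incl k u).
Proof.
by move=> hu; apply: (homog_lin_ext hu) => a <-; apply: homogU.
Qed.

Lemma homog_Delta_hat w : homog thdeg (hdeg w) (@Delta_hat k << w >>).
Proof.
have h := homog_tens (dA := hdeg) (dB := hdeg) (d := thdeg) (s := 0).
rewrite /Delta_hat lin_extU; case: w => [w|]; last first.
  by apply: (h 0 0) => //; exact: homogU.
apply: homogD; last first.
  by rewrite -[hdeg _]addn0 -[hdeg _]addn0; apply: h => //; exact: homogU.
apply: homogD; last first.
  by rewrite -[hdeg _]add0n -[(0 + _)%N]addn0; apply: h => //; exact: homogU.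
rewrite /Delta lin_extU.
apply: (homog_lin_ext (@homog_Delta_word w)) => -[a b] /= <-.
rewrite /tdeg /= addn1 -addSn -addn1 addn1 -addnS -[X in homog _ X _]addn0.
by apply: h => //; apply: homog_incl; exact: homogU.
Qed.

Lemma homog_G_hat w : homog hdeg (hdeg w).+1 (@cdG_hat k << w >>).
Proof.
rewrite /cdG_hat lin_extU; case: w => [w|]; last first.
  by apply: homog_incl; exact: homog1.
apply: homog_incl; rewrite /cdG lin_extU.
apply: homogD; first exact: homog_G_word.
rewrite -[hdeg _]/((wdeg w).+1) -addn1.
by apply: homogM; [exact: homogU|exact: homog_word].
Qed.

Lemma cdmul_coef u v w :
  (cdmul << u >> << v >> : Fh)@_w = (Delta_hat (<< w >> : Fh))@_(u, v).
Proof.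
rewrite /cdmul tensU; apply: transposeE; first exact: hwords_uniq.
by move/homog_Delta_hat; rewrite /thdeg addn0 mem_hwords => ->.
Qed.

Lemma cdS_coef v w : (cdS << v >> : Fh)@_w = (cdG_hat (<< w >> : Fh))@_v.
Proof.
apply: transposeE; first exact: hwords_uniq.
by move/homog_G_hat; rewrite mem_hwords => ->.
Qed.

Lemma cdS_linear : linear (@cdS k).
Proof. exact: lin_ext_is_linear. Qed.

Lemma cdmul_linearl (v : Fh) : linear (fun u : Fh => cdmul u v).
Proof. by move=> c x y; rewrite /cdmul tens_linearl /cdmulT /transpose linearP. Qed.

Lemma cdmul_linearr (u : Fh) : linear (fun v : Fh => cdmul u v).
Proof. by move=> c x y; rewrite /cdmul tens_linearr /cdmulT /transpose linearP. Qed.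

End CDTheory.

(* Main.v *)
Require Import Defs.
From mathcomp Require Import all_boot all_order all_algebra.
From mathcomp Require Import finmap monalg.
Import GRing.Theory.
Local Open Scope ring_scope.

(** Transposing, S is a derivation of the product if and only if Delta_hat
    intertwines cdG_hat with [id (x) cdG_hat + cdG_hat (x) id].  On F this reads
    [Delta (G u) = K (Delta u) + 1 (x) u - u (x) 1], where
    [K = id (x) G + G (x) id + (. c) (x) id].  As functions of u,
    [Delta (G u) - K (Delta u)] and [1 (x) u - u (x) 1] are both derivations
    from F to the bimodule F (x) F, so it suffices to compare them on c and d. *)

(** * The coefficient pairing and adjoint maps *)

Section Dot.
Context {k : fieldType}.

(** The pairing that makes the monomial basis orthonormal; it identifies the free module with its
    graded dual, so that transposes become adjoints. *)
Definition dot {A : choiceType} (x y : {malg k[A]}) : k :=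
  \sum_(a <- msupp x) x@_a * y@_a.

Definition adjoint {A B : choiceType} (f : {malg k[A]} -> {malg k[B]})
    (g : {malg k[B]} -> {malg k[A]}) :=
  forall x y, dot (f x) y = dot x (g y).

Lemma dot_lin_ext (A : choiceType) (x y : {malg k[A]}) :
  dot x y = lin_ext (fun a => y@_a : k^o) x.
Proof. by rewrite lin_extE. Qed.

Lemma dotDZl (A : choiceType) c (x x' y : {malg k[A]}) :
  dot (c *: x + x') y = c * dot x y + dot x' y.
Proof. by rewrite !dot_lin_ext linearP. Qed.

Lemma dotDZr (A : choiceType) c (x y y' : {malg k[A]}) :
  dot x (c *: y + y') = c * dot x y + dot x y'.
Proof.
rewrite /dot mulr_sumr -big_split; apply: eq_bigr => a _ /=.
by rewrite mcoeffD mcoeffZ mulrDr mulrCA.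
Qed.

Lemma dotDr (A : choiceType) (x y y' : {malg k[A]}) :
  dot x (y + y') = dot x y + dot x y'.
Proof. by have := dotDZr _ 1 x y y'; rewrite scale1r mul1r. Qed.

Lemma dotDl (A : choiceType) (x x' y : {malg k[A]}) :
  dot (x + x') y = dot x y + dot x' y.
Proof. by have := dotDZl _ 1 x x' y; rewrite scale1r mul1r. Qed.

Lemma dotUl (A : choiceType) a (y : {malg k[A]}) : dot << a >> y = y@_a.
Proof. by rewrite dot_lin_ext lin_extU. Qed.

Lemma dotUr (A : choiceType) (x : {malg k[A]}) a : dot x << a >> = x@_a.
Proof.
rewrite [in RHS](malg_lin_ext x) mcoeff_lin_ext.
by apply: eq_bigr => b _; rewrite !mcoeffU eq_sym.
Qed.

Lemma adjoint_basis (A B : choiceType) (f : {malg k[A]} -> {malg k[B]})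
    (g : {malg k[B]} -> {malg k[A]}) :
  linear f -> linear g ->
  (forall a b, (f << a >>)@_b = (g << b >>)@_a) -> adjoint f g.
Proof.
move=> lf lg fg x y; move: x.
(* Both pairings are linear in each argument, so basis elements suffice; [k^o] is [k] as a module
   over itself. *)
apply: (@malg_linear_ext k A k^o) => [c u v|c u v|a].
- by rewrite lf dotDZl.
- exact: dotDZl.
move: y; apply: (@malg_linear_ext k B k^o) => [c u v|c u v|b].
- exact: dotDZr.
- by rewrite lg dotDZr.
by rewrite dotUl dotUr fg.
Qed.

(** On pairs of basis elements the pairing factors over the two tensor slots, and each factor is
    handled by its own adjunction. *)
Lemma adjoint_tmap (A B A' B' : choiceType)
    (f : {malg k[A]} -> {malg k[A']}) (f' : {malg k[A']} -> {malg k[A]})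
    (g : {malg k[B]} -> {malg k[B']}) (g' : {malg k[B']} -> {malg k[B]}) :
  adjoint f f' -> adjoint g g' -> adjoint (tmap f g) (tmap f' g').
Proof.
move=> ff gg; apply: adjoint_basis => [c s t|c s t|[a b] [a' b']].
- by rewrite linearP.
- by rewrite linearP.
by rewrite /tmap !lin_extU !mcoeff_tens /= -!dotUr ff gg !dotUr -!dotUl.
Qed.

Lemma adjoint_id (A : choiceType) : adjoint (@id {malg k[A]}) id.
Proof. by []. Qed.

Lemma adjoint_cdS : adjoint (@cdS k) (@cdG_hat k).
Proof.
apply: adjoint_basis => [||a b]; [exact: cdS_linear| |exact: cdS_coef].
exact: lin_ext_is_linear.
Qed.

Lemma adjoint_cdmulT : adjoint (@cdmulT k) (@Delta_hat k).
Proof.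
apply: adjoint_basis => [||[u v] w]; try exact: lin_ext_is_linear.
by rewrite -cdmul_coef /cdmul tensU.
Qed.

End Dot.

(* These rearrangements are proved in an abstract group because a failing
   unification of two sums in {malg k[_]} unfolds them down to finite maps. *)
Lemma add_telescope (V : zmodType) (a b c d x y z a' d' : V) :
  a + x = a' + z -> d + y = d' + x ->
  a + b + (c + d) + y = a' + c + (d' + b) + z.
Proof.
move=> hu hv; apply: (addIr x).
have -> : a + b + (c + d) + y + x = (a + x) + (d + y) + (b + c).
  by rewrite !addrA [LHS](ACl (1*6*4*5*2*3))%AC.
by rewrite hu hv !addrA [LHS](ACl (1*6*3*5*2*4))%AC.
Qed.

Lemma addr_rot3 (V : zmodType) (x y z w : V) : x + y + z + w = x + z + w + y.
Proof. by rewrite [LHS](ACl (1*3*4*2))%AC. Qed.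

Lemma add_d_case (V : zmodType) (x y z w : V) :
  x + x + (y + z) + w = x + y + (w + z) + x.
Proof. by rewrite !addrA [LHS](ACl (1*3*5*4*2))%AC. Qed.

Lemma add_double (V : zmodType) (a r x y z : V) :
  a + x = z + y -> a + (r + (x + x)) = z + r + (y + x).
Proof.
move=> h; have -> : a + (r + (x + x)) = a + x + (r + x).
  by rewrite !addrA [LHS](ACl (1*3*2*4))%AC.
by rewrite h !addrA [LHS](ACl (1*3*2*4))%AC.
Qed.

Lemma add_regroup (V : zmodType) (a b p q x y : V) :
  a + b + (p + q) + x + y = a + x + q + (b + p + y).
Proof. by rewrite !addrA [LHS](ACl (1*5*4*2*3*6))%AC. Qed.

(** * The commutation rule for [Delta] and [cdG] on F *)

Section Coderivation.
Context (k : fieldType).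
Local Notation F := (cdF k).
Local Notation Fh := (cdFh k).
Local Notation FF := {malg k[(cdmon * cdmon)%type]}.

(** Only the left slot is multiplied by [cdc] here: the matching term on the right slot arises from
    [Delta (u * cdc)] in [Delta_G_mulc]. *)
Definition Kop (t : FF) : FF :=
  tmap id (@cdG k) t + tmap (@cdG k) id t + tmap ( *%R^~ (cdc : F)) id t.

Lemma Kop_linear : linear Kop.
Proof. by move=> c s t; rewrite /Kop !linearP !lin_add. Qed.

Lemma KopD s t : Kop (s + t) = Kop s + Kop t.
Proof. by have := Kop_linear 1 s t; rewrite !scale1r. Qed.

Lemma cdG_linear : linear (@cdG k).
Proof. exact: lin_ext_is_linear. Qed.

Lemma Delta_linear : linear (@Delta k).
Proof. exact: lin_ext_is_linear. Qed.

Lemma DeltaD (u v : F) : Delta (u + v) = Delta u + Delta v.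
Proof. exact: linearD. Qed.

Lemma Kop_tens (x y : F) :
  Kop (tens x y) = tens x (cdG y) + tens (cdG x) y + tens (x * cdc) y.
Proof.
have lG := cdG_linear; have lc := mulr_linear (cdc : F).
have li := @id_linear k cdmon.
rewrite /Kop (tmap_tens _ _ li lG) (tmap_tens _ _ lG li).
by rewrite (tmap_tens _ _ lc li).
Qed.

Lemma ract_tens (x y v : F) : ract (tens x y) v = tens x (y * v).
Proof. exact: tmap_tens (@id_linear k _) (mulr_linear v). Qed.

Lemma lact_tens (u x y : F) : lact u (tens x y) = tens (u * x) y.
Proof. exact: tmap_tens (mull_linear u) (@id_linear k _). Qed.

Lemma tensDl (A B : choiceType) (x x' : {malg k[A]}) (y : {malg k[B]}) :
  tens (x + x') y = tens x y + tens x' y.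
Proof. by have := tens_linearl y 1 x x'; rewrite !scale1r. Qed.

Lemma tensDr (A B : choiceType) (x : {malg k[A]}) (y y' : {malg k[B]}) :
  tens x (y + y') = tens x y + tens x y'.
Proof. by have := tens_linearr x 1 y y'; rewrite !scale1r. Qed.

Lemma tens0l (y : F) : tens 0 y = 0 :> FF.
Proof. by apply: (addIr (tens 0 y)); rewrite -tensDl !add0r. Qed.

Lemma tens0r (x : F) : tens x 0 = 0 :> FF.
Proof. by apply: (addIr (tens x 0)); rewrite -tensDr !add0r. Qed.

(** Right multiplication touches only the right slot, where [cdG] obeys the Leibniz rule; the other
    two summands of [Kop] commute with it. *)
Lemma Kop_ract t (v : F) : Kop (ract t v) = ract (Kop t) v + ract t (cdG v).
Proof.
move: t; apply: malg_linear_ext => [c s t|c s t|[a b]].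
- by rewrite ract_linearl Kop_linear.
- by rewrite Kop_linear !ract_linearl lin_add.
rewrite -tensU ract_tens !Kop_tens !ractD !ract_tens cdGM tensDr.
exact: addr_rot3.
Qed.

Lemma Kop_lact t (u : F) : Kop (lact u t) = lact u (Kop t) + lact (cdG u) t.
Proof.
move: t; apply: malg_linear_ext => [c s t|c s t|[a b]].
- by rewrite lact_linearr Kop_linear.
- by rewrite Kop_linear !lact_linearr lin_add.
rewrite -tensU lact_tens !Kop_tens !lactD !lact_tens cdGM tensDl mulrA.
rewrite [tens _ _ + (_ + _)]addrA.
exact: addr_rot3.
Qed.

Definition Delta_G_rule (u : F) :=
  Delta (cdG u) + tens u 1 = Kop (Delta u) + tens 1 u.

(** Multiplying the rule for [u] by [v] on the right and the rule for [v] by [u] on the left puts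
    [tens u v] on opposite sides, so it cancels in the sum. The cross terms with [cdG u] and [cdG v]
    agree on both sides. *)
Lemma Delta_G_ruleM u v :
  Delta_G_rule u -> Delta_G_rule v -> Delta_G_rule (u * v).
Proof.
rewrite /Delta_G_rule => hu hv.
have {}hu : ract (Delta (cdG u)) v + tens u v
          = ract (Kop (Delta u)) v + tens 1 (u * v).
  by have := congr1 (fun t => ract t v) hu; rewrite !ractD !ract_tens mul1r.
have {}hv : lact u (Delta (cdG v)) + tens (u * v) 1
          = lact u (Kop (Delta v)) + tens u v.
  by have := congr1 (lact u) hv; rewrite !lactD !lact_tens mulr1.
have DG : Delta (cdG (u * v))
    = ract (Delta (cdG u)) v + lact (cdG u) (Delta v)
      + (ract (Delta u) (cdG v) + lact u (Delta (cdG v))).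
  by rewrite cdGM DeltaD; congr (_ + _); exact: DeltaM.
have KD : Kop (Delta (u * v))
    = ract (Kop (Delta u)) v + ract (Delta u) (cdG v)
      + (lact u (Kop (Delta v)) + lact (cdG u) (Delta v)).
  by rewrite DeltaM KopD Kop_ract Kop_lact.
rewrite DG KD; exact: add_telescope hu hv.
Qed.

Lemma Delta_G_rule_all u : Delta_G_rule u.
Proof.
move: u; apply: malg_linear_ext => [c x y|c x y|[w]].
- by rewrite cdG_linear Delta_linear tens_linearl lin_add.
- by rewrite Delta_linear Kop_linear tens_linearr lin_add.
elim: w => [|l w IH].
  rewrite -cdword0 /Delta_G_rule cdG1 Delta1 [Delta 0]linear0 /Kop !linear0.
  by rewrite !addr0.
(* Splitting off the first letter leaves the two generators to be checked by computation. *)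
rewrite -cat1s -cdwordM; apply: Delta_G_ruleM IH; case: l.
  rewrite -/cdc /Delta_G_rule cdG_c Delta_c Delta_d.
  rewrite (_ : 2 *: tens 1 1 = tens 1 1 + tens 1 1); last first.
    by rewrite scaler_nat mulr2n.
  rewrite KopD Kop_tens cdG1 mul1r tens0l tens0r !add0r.
  by rewrite -addrA; exact: addrC.
rewrite -/cdd /Delta_G_rule cdG_d Delta_d DeltaM Delta_c Delta_d.
rewrite KopD !Kop_tens cdG1 cdG_c mul1r tens0l tens0r addr0 add0r.
rewrite scaler_nat mulr2n ractD lactD !ract_tens !lact_tens !mul1r mulr1.
exact: add_d_case.
Qed.

(** Of the two copies of [tens u 1] produced by [Delta cdc], one is absorbed by the rule in exchange
    for [tens 1 u], and the other remains. *)
Lemma Delta_G_mulc (u : F) :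
  Delta (cdG u + u * cdc)
  = Kop (Delta u) + ract (Delta u) cdc + (tens 1 u + tens u 1).
Proof.
rewrite DeltaD DeltaM Delta_c scaler_nat mulr2n lactD lact_tens.
by rewrite mulr1; apply: add_double; exact: Delta_G_rule_all.
Qed.

(** * Extension of the rule from F to F with [cd_e] adjoined *)

Local Notation J := (tmap (@cd_incl k) (@cd_incl k)).

Lemma G_hat_linear : linear (@cdG_hat k).
Proof. exact: lin_ext_is_linear. Qed.

Lemma incl_linear : linear (@cd_incl k).
Proof. exact: lin_ext_is_linear. Qed.

Lemma tmap_id_G_hat (t : FF) :
  tmap id (@cdG_hat k) (J t) = J (tmap id (@cdG k) t + ract t cdc).
Proof.
move: t; apply: malg_linear_ext => [c s t|c s t|[a b]].
- by rewrite !linearP.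
- by rewrite linearP ract_linearl lin_add linearP.
rewrite -tensU [in RHS](tmap_tens _ _ (@id_linear k _) cdG_linear) ract_tens.
rewrite -tensDr (tmap_tens _ _ incl_linear incl_linear).
rewrite (tmap_tens _ _ (@id_linear k _) G_hat_linear) cdG_hat_incl.
by rewrite (tmap_tens _ _ incl_linear incl_linear).
Qed.

Lemma tmap_G_hat_id (t : FF) :
  tmap (@cdG_hat k) id (J t)
  = J (tmap (@cdG k) id t + tmap ( *%R^~ (cdc : F)) id t).
Proof.
move: t; apply: malg_linear_ext => [c s t|c s t|[a b]].
- by rewrite !linearP.
- by rewrite !linearP lin_add linearP.
rewrite -tensU [in RHS](tmap_tens _ _ cdG_linear (@id_linear k _)).
rewrite [in RHS](tmap_tens _ _ (mulr_linear (cdc : F)) (@id_linear k _)).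
rewrite -tensDl (tmap_tens _ _ incl_linear incl_linear).
rewrite (tmap_tens _ _ G_hat_linear (@id_linear k _)) cdG_hat_incl.
by rewrite (tmap_tens _ _ incl_linear incl_linear).
Qed.

Lemma G_hat_tmap_incl (t : FF) :
  tmap id (@cdG_hat k) (J t) + tmap (@cdG_hat k) id (J t)
  = J (Kop t + ract t cdc).
Proof.
rewrite tmap_id_G_hat tmap_G_hat_id -linearD; congr (J _).
by rewrite [LHS]addrA; exact: addr_rot3.
Qed.

Lemma Delta_hat_G_hat (x : Fh) :
  Delta_hat (cdG_hat x)
  = tmap id (@cdG_hat k) (Delta_hat x) + tmap (@cdG_hat k) id (Delta_hat x).
Proof.
have [lG lI li] := And3 G_hat_linear incl_linear (@id_linear k (option cdmon)).
move: x; apply: malg_linear_ext => [c s t|c s t|[w|]].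
- by rewrite lG linearP.
- by rewrite !linearP lin_add.
- rewrite -cd_inclU; move: (<< w >> : F) => u.
  rewrite cdG_hat_incl 2!Delta_hat_incl Delta_G_mulc.
  (* The terms with 1 in one slot will be matched by [cdG_hat] sending [cd_e] to 1 in the summands
     of [Delta_hat] that contain [cd_e]. *)
  have -> : J (Kop (Delta u) + ract (Delta u) cdc + (tens 1 u + tens u 1))
    = tmap id (@cdG_hat k) (J (Delta u)) + tmap (@cdG_hat k) id (J (Delta u))
      + (tens (cd_incl 1) (cd_incl u) + tens (cd_incl u) (cd_incl 1)).
    rewrite G_hat_tmap_incl linearD; congr (_ + _).
    by rewrite linearD /= !(tmap_tens _ _ lI lI).
  have -> : tmap id (@cdG_hat k) (J (Delta u) + tens cd_e (cd_incl u)
                                  + tens (cd_incl u) cd_e)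
    = tmap id (@cdG_hat k) (J (Delta u)) + tens cd_e (cd_incl (cdG u + u * cdc))
      + tens (cd_incl u) (cd_incl 1).
    by rewrite 2!linearD /= !(tmap_tens _ _ li lG) cdG_hat_e cdG_hat_incl.
  have -> : tmap (@cdG_hat k) id (J (Delta u) + tens cd_e (cd_incl u)
                                  + tens (cd_incl u) cd_e)
    = tmap (@cdG_hat k) id (J (Delta u)) + tens (cd_incl 1) (cd_incl u)
      + tens (cd_incl (cdG u + u * cdc)) cd_e.
    by rewrite 2!linearD /= !(tmap_tens _ _ lG li) cdG_hat_e cdG_hat_incl.
  exact: add_regroup.
(* For [cd_e], both sides reduce to the sum of its two tensors with 1. *)
rewrite -/cd_e cdG_hat_e Delta_hat_incl Delta1 linear0 add0r Delta_hat_e.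
by rewrite (tmap_tens _ _ li lG) (tmap_tens _ _ lG li) cdG_hat_e.
Qed.

End Coderivation.

Theorem theorem3p1 (k : fieldType) (char0 : [pchar k] =i pred0) :
  [/\ forall t : {malg k[(option cdmon * option cdmon)%type]},
        cdS (cdmulT t) = cdmulT (tmap id (@cdS k) t + tmap (@cdS k) id t),
      forall u v : cdFh k,
        cdS (cdmul u v) = cdmul (cdS u) v + cdmul u (cdS v),
      cdS (cd_incl (1 : cdF k)) = cd_e
    & cdS (cd_e : cdFh k) = 0].
Proof.
have derS t :
    cdS (cdmulT t) = cdmulT (tmap id (@cdS k) t + tmap (@cdS k) id t).
  (* Each coefficient at [w] is a pairing with a basis element, so all maps can be moved to the
     other argument. *)
  apply/malgP => w; rewrite -!dotUr adjoint_cdS !adjoint_cdmulT.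
  rewrite dotDl Delta_hat_G_hat dotDr.
  by rewrite !(adjoint_tmap _ _ _ _ _ _ _ _ (adjoint_id _) adjoint_cdS)
     !(adjoint_tmap _ _ _ _ _ _ _ _ adjoint_cdS (adjoint_id _)).
split=> // [u v||].
- rewrite {1}/cdmul derS !tmap_tens; try exact: id_linear; try exact: cdS_linear.
  by rewrite linearD addrC.
- apply/malgP => w; rewrite cdword0 cd_inclU cdS_coef mcoeffU.
  case: w => [w|]; last first.
    by rewrite [<< None >>]/(cd_e : cdFh k) cdG_hat_e cdword0 cd_inclU mcoeffUU.
  (* The monomial 1 has shifted degree 1, whereas [cdG_hat] of a cd-monomial has shifted degree at
     least 2. *)
  by apply/eqP/idPn => /homog_G_hat.
(* The shifted degree of [cd_e] is 0, while everything in the image of [cdG_hat] has positive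
   shifted degree. *)
by apply/malgP => w; rewrite cdS_coef mcoeff0; apply/eqP/idPn => /homog_G_hat.
Qed.
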